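(* Let $A\in\mathbb{C}^{m\times n}$ be a matrix arising at some stage in the computation of a loss function $\mathcal{L}$, and suppose its singular value decomposition $A=USV^H$ is computed, with $U\in\mathbb{C}^{m\times k}$, $V\in\mathbb{C}^{n\times k}$, $S\in\mathbb{R}^{k\times k}$ and $\operatorname{rank}(A)<k<\min(m,n)$, so that $\mathcal{L}=\mathcal{L}(U,S,V)$. Let $\overline{U},\overline{S},\overline{V}$ be the partial derivatives of $\mathcal{L}$ with respect to $U,S,V$. Then the derivative of $\mathcal{L}$ with respect to $A$ is $$\begin{aligned}\frac{\partial \mathcal{L}}{\partial A}=\;&U\left[\left(F \odot [U^H\overline{U}-\overline{U}^HU]\right)S+T\odot (U^H\overline{U})\right]V^H +(I_m-UU^H)\overline{U}S^{-1}V^H \\ &+U(I_k \odot \overline{S})V^H+ US\left(F \odot [V^H\overline{V}-\overline{V}^HV]\right)V^H +US^{-1}\overline{V}^H(I_n-VV^H),\end{aligned}$$ where the matrices $F$, $T$ and $S^{-1}$ are as defined in the context.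
   Context: In the singular value decomposition $A=USV^H$, $U^HU=V^HV=I_k$ and $S=\operatorname{diag}(\sigma_1,\dots,\sigma_k)$ is the real diagonal matrix of singular values. $I_r$ is the $r\times r$ identity matrix, $(\cdot)^H$ is the conjugate transpose, $\odot$ is the Hadamard (entrywise) product, $tr$ is the trace. $F$ and $T$ are the $k\times k$ matrices with $F_{ij}=0$ if $\sigma_i=\sigma_j$ and $F_{ij}=\frac{1}{\sigma_j^2-\sigma_i^2}$ otherwise; $T_{ij}=\frac{1}{\sigma_i}$ if $\sigma_i=\sigma_j\neq 0$ and $i\neq j$, and $T_{ij}=0$ otherwise. $S^{-1}$ is the $k\times k$ diagonal matrix whose $i$-th diagonal entry is $1/\sigma_i$ if $\sigma_i\ne0$ and $0$ if $\sigma_i=0$. The derivatives are defined through the total differential $$d\mathcal{L} = tr(\overline{U}^HdU)+tr(\overline{S}^HdS)+tr(\overline{V}^HdV) = tr\left(\left(\frac{\partial \mathcal{L}}{\partial A}\right)^H dA\right),$$ where the differentials of the paper's differentiable SVD (''SVD-inv'') are the following functions of $dA$ (with $dA^H=(dA)^H$): $$dU = U\left(F\odot[U^H dA\,V S+S V^H dA^H U]+T\odot [U^H dA\,V]\right)+(I_m-UU^H)\,dA\,V S^{-1},$$ $$dS = I_k \odot [U^H dA\,V],$$ $$dV = V\left(F\odot[S U^H dA\,V+V^H dA^H U S]\right)+(I_n-VV^H)\,dA^H U S^{-1}.$$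
   Formalization: The traces in the total differential defining the derivatives are replaced by their real parts (and the loss's differential is taken at the real part of dS), since for complex matrices dU and dV involve both dA and its conjugate transpose, so the literal identity has in general no solution. *)

(* Defs.v *)
From HB Require Import structures.
From mathcomp Require Import all_boot all_order all_algebra complex.
From mathcomp Require Import all_classical all_reals all_analysis.

Set Implicit Arguments.
Unset Strict Implicit.
Unset Printing Implicit Defensive.

Import Order.TTheory GRing.Theory Num.Theory.
Import numFieldNormedType.Exports.

Local Open Scope ring_scope.

(* The conjugate transpose is the [M ^t*] of the library file spectral.v. *)
Local Open Scope sesquilinear_scope.

Definition toC (R : realType) (p q : nat) (M : 'M[R]_(p, q)) : 'M[R[i]]_(p, q) :=
  map_mx (real_complex R) M.

Definition cmx (R : realType) (p q : nat) (X Y : 'M[R]_(p, q)) :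
    'M[R[i]]_(p, q) :=
  \matrix_(i, j) Complex (X i j) (Y i j).

Definition Remx (R : realType) (p q : nat) (Z : 'M[R[i]]_(p, q)) : 'M[R]_(p, q) :=
  map_mx (@complex.Re R) Z.

Definition Immx (R : realType) (p q : nat) (Z : 'M[R[i]]_(p, q)) : 'M[R]_(p, q) :=
  map_mx (@complex.Im R) Z.

Definition hadamard (K : pzRingType) (p q : nat) (X Y : 'M[K]_(p, q)) :
    'M[K]_(p, q) :=
  map2_mx *%R X Y.

(* The singular values are carried by the row vector [s], with S = diag(s). *)
Definition is_svd (R : realType) (m n k : nat) (A : 'M[R[i]]_(m, n))
    (U : 'M[R[i]]_(m, k)) (s : 'rV[R]_k) (V : 'M[R[i]]_(n, k)) : Prop :=
  [/\ A = U *m toC (diag_mx s) *m V ^t*,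
      U ^t* *m U = 1%:M,
      V ^t* *m V = 1%:M
    & forall i, 0 <= s 0 i].

Definition Fmx (R : realType) (k : nat) (s : 'rV[R]_k) : 'M[R[i]]_k :=
  toC (\matrix_(i, j)
    (if s 0 i == s 0 j then 0 else 1 / (s 0 j ^+ 2 - s 0 i ^+ 2))).

Definition Tmx (R : realType) (k : nat) (s : 'rV[R]_k) : 'M[R[i]]_k :=
  toC (\matrix_(i, j)
    (if [&& s 0 i == s 0 j, s 0 i != 0 & i != j] then 1 / s 0 i else 0)).

Definition Sinv (R : realType) (k : nat) (s : 'rV[R]_k) : 'M[R[i]]_k :=
  toC (diag_mx (\row_i (if s 0 i == 0 then 0 else 1 / s 0 i))).

Section SVDinv.
Variables (R : realType) (m n k : nat).
Variables (U : 'M[R[i]]_(m, k)) (s : 'rV[R]_k) (V : 'M[R[i]]_(n, k)).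

Let S : 'M[R[i]]_k := toC (diag_mx s).

Definition svdinv_dU (dA : 'M[R[i]]_(m, n)) : 'M[R[i]]_(m, k) :=
  U *m (hadamard (Fmx s)
          (U ^t* *m dA *m V *m S + S *m V ^t* *m dA ^t* *m U)
        + hadamard (Tmx s) (U ^t* *m dA *m V))
  + (1%:M - U *m U ^t*) *m dA *m V *m Sinv s.

Definition svdinv_dS (dA : 'M[R[i]]_(m, n)) : 'M[R[i]]_k :=
  hadamard 1%:M (U ^t* *m dA *m V).

Definition svdinv_dV (dA : 'M[R[i]]_(m, n)) : 'M[R[i]]_(n, k) :=
  V *m hadamard (Fmx s)
         (S *m U ^t* *m dA *m V + V ^t* *m dA ^t* *m U *m S)
  + (1%:M - V *m V ^t*) *m dA ^t* *m U *m Sinv s.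

End SVDinv.

(* Real coordinates ((((Re U, Im U), S), Re V), Im V) of (U, S, V).  A
   real-valued function of complex matrices is not complex differentiable: its
   differential is the one of the underlying function of real matrices. *)
Notation real_coords R m n k :=
  ('M[R]_(m, k) * 'M[R]_(m, k) * 'M[R]_k * 'M[R]_(n, k) * 'M[R]_(n, k))%type.

Section Loss.
Variables (R : realType) (m n k : nat).

Definition coords (U : 'M[R[i]]_(m, k)) (S : 'M[R]_k) (V : 'M[R[i]]_(n, k)) :
    real_coords R m n k :=
  (Remx U, Immx U, S, Remx V, Immx V).

Definition in_coords
    (f : 'M[R[i]]_(m, k) -> 'M[R]_k -> 'M[R[i]]_(n, k) -> R)
    (x : real_coords R m n k) : R :=
  let: (X, Y, D, Z, W) := x in f (cmx X Y) D (cmx Z W).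

Variable L : 'M[R[i]]_(m, k) -> 'M[R]_k -> 'M[R[i]]_(n, k) -> R.
Variables (Ubar : 'M[R[i]]_(m, k)) (Sbar : 'M[R]_k) (Vbar : 'M[R[i]]_(n, k)).

(* tr(Ubar^H dU) + tr(Sbar^H dS) + tr(Vbar^H dV).  The real part is needed
   because dU and dV involve both dA and dA^H, whereas the differential of a
   real loss is a real number: complex matrices are paired by the real inner
   product Re tr(X^H Y). *)
Definition dloss (dU : 'M[R[i]]_(m, k)) (dS : 'M[R[i]]_k)
    (dV : 'M[R[i]]_(n, k)) : R :=
  complex.Re (\tr (Ubar ^t* *m dU) + \tr ((toC Sbar) ^t* *m dS)
              + \tr (Vbar ^t* *m dV)).

(* Ubar, Sbar, Vbar are the partial derivatives of L at (U, S, V): L is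
   (real-)differentiable there, with total differential [dloss]. *)
Definition partial_derivatives (U : 'M[R[i]]_(m, k)) (S : 'M[R]_k)
    (V : 'M[R[i]]_(n, k)) : Prop :=
  is_diff (coords U S V) (in_coords L)
    (in_coords (fun dU dS dV => dloss dU (toC dS) dV)).

(* G is dL/dA: the differential of L along the SVD-inv differentials of dA is
   the sum of traces, and equals Re tr(G^H dA).  Since L takes a real matrix S,
   its differential is evaluated at the real part of the complex matrix dS. *)
Definition is_svdinv_derivative (U : 'M[R[i]]_(m, k)) (s : 'rV[R]_k)
    (V : 'M[R[i]]_(n, k)) (G : 'M[R[i]]_(m, n)) : Prop :=
  forall dA : 'M[R[i]]_(m, n),
    let dU := svdinv_dU U s V dA in
    let dS := svdinv_dS U V dA in
    let dV := svdinv_dV U s V dA in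
    'd (in_coords L) (coords U (diag_mx s) V) (coords dU (Remx dS) dV)
      = dloss dU dS dV
    /\ dloss dU dS dV = complex.Re (\tr (G ^t* *m dA)).

End Loss.

(* Main.v *)
Require Import Defs.
From HB Require Import structures.
From mathcomp Require Import all_boot all_order all_algebra complex.
From mathcomp Require Import all_classical all_reals all_analysis.

Set Implicit Arguments.
Unset Strict Implicit.
Unset Printing Implicit Defensive.

Import Order.TTheory GRing.Theory Num.Theory.
Import numFieldNormedType.Exports.

Local Open Scope ring_scope.
Local Open Scope sesquilinear_scope.

(** Complex matrices of a given size form a real Euclidean space for the pairing
    Re tr(X^H Y), and the total differential of the loss is the pairing of
    (Ubar, Sbar, Vbar) with (dU, dS, dV).  The SVD-inv differentials dU, dS, dV
    are real linear in dA, so that the differential of the loss is a real linear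
    form in dA; the derivative dL/dA is the matrix that represents this form.
    It is unique because the pairing is definite ([repairI]), and it is obtained
    by adding the images of Ubar, Sbar, Vbar under the adjoints of dA |-> dU, dS,
    dV ([dU_adjoint], [dS_adjoint], [dV_adjoint]).  The differential of the loss
    only takes the real part of dS, but so does the pairing of dS with the real
    matrix Sbar ([repair_toC_Remx]), so that the chain rule through the
    real coordinates of (U, S, V) gives exactly this sum of pairings.

    These adjoints are computed from three rules: a left or right factor moves
    to the other side as its conjugate transpose ([repair_mulmx]), conjugate
    transposition is self-adjoint ([repair_trmxC]), and so is the Hadamard
    product by a real matrix ([repair_hadamard]).  The only step which is not
    a plain application of them is the symmetrized bracket M S + (M S)^H, with
    M = U^H dA V, under the Hadamard product by F.  As F is real and
    antisymmetric, the adjoint of this operation is P |-> F o (P - P^H)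
    ([repair_hadamard_herm]).  This is where the differences
    U^H Ubar - Ubar^H U and V^H Vbar - Vbar^H V come from. *)

(** * Conjugate transposition *)

Section Adjoint.
Variable C : numClosedFieldType.

Lemma trmxC_mul p q r (X : 'M[C]_(p, q)) (Y : 'M[C]_(q, r)) :
  (X *m Y) ^t* = Y ^t* *m X ^t*.
Proof. by rewrite trmx_mul map_mxM. Qed.

Lemma trmxC1 p : (1%:M : 'M[C]_p) ^t* = 1%:M.
Proof. by rewrite trmx1 map_mx1. Qed.

Lemma trmxC_compl p q (X : 'M[C]_(p, q)) :
  (1%:M - X *m X ^t*) ^t* = 1%:M - X *m X ^t*.
Proof. by rewrite linearB map_mxB trmxC1 trmxC_mul trmxCK. Qed.

(** * The real inner product of complex matrices *)

(** The real pairing is kept with values in C, where a real number is a fixed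
    point of conjugation, so that the adjoints below hold over any closed field
    with a conjugation. *)
Definition repair p q (X Y : 'M[C]_(p, q)) : C := 'Re (\tr (X ^t* *m Y)).

Lemma repairDr p q (X Y Z : 'M[C]_(p, q)) :
  repair X (Y + Z) = repair X Y + repair X Z.
Proof. by rewrite /repair mulmxDr mxtraceD raddfD. Qed.

Lemma repairDl p q (X Y Z : 'M[C]_(p, q)) :
  repair (X + Y) Z = repair X Z + repair Y Z.
Proof. by rewrite /repair linearD map_mxD mulmxDl mxtraceD raddfD. Qed.

Lemma repairNl p q (X Y : 'M[C]_(p, q)) : repair (- X) Y = - repair X Y.
Proof. by rewrite /repair linearN map_mxN mulNmx !raddfN. Qed.

Lemma repair_mulmx p q r t (X : 'M[C]_(p, t)) (B : 'M[C]_(p, q))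
    (Y : 'M[C]_(q, r)) (D : 'M[C]_(r, t)) :
  repair X (B *m Y *m D) = repair (B ^t* *m X *m D ^t*) Y.
Proof.
by rewrite /repair !trmxC_mul !trmxCK mulmxA mxtrace_mulC !mulmxA.
Qed.

Lemma repair_mulmxl p q r (X : 'M[C]_(p, r)) (B : 'M[C]_(p, q))
    (Y : 'M[C]_(q, r)) :
  repair X (B *m Y) = repair (B ^t* *m X) Y.
Proof. by rewrite -[B *m Y]mulmx1 repair_mulmx trmxC1 mulmx1. Qed.

Lemma repair_mulmxr p q r (X : 'M[C]_(p, r)) (Y : 'M[C]_(p, q))
    (D : 'M[C]_(q, r)) :
  repair X (Y *m D) = repair (X *m D ^t*) Y.
Proof. by rewrite -[Y in LHS]mul1mx repair_mulmx trmxC1 mul1mx. Qed.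

Lemma repair_trmxC p q (X : 'M[C]_(p, q)) (Y : 'M[C]_(q, p)) :
  repair X (Y ^t*) = repair (X ^t*) Y.
Proof.
rewrite /repair trmxCK -trmxC_mul trace_map_mx mxtrace_tr.
by rewrite Re_conj mxtrace_mulC.
Qed.

Lemma repair_sum p q (X Y : 'M[C]_(p, q)) :
  repair X Y = 'Re (\sum_j \sum_i (X i j)^* * Y i j).
Proof.
congr ('Re _); apply: eq_bigr => j _; rewrite mxE.
by apply: eq_bigr => i _; rewrite !mxE.
Qed.

Lemma repair_hadamard p q (F X Y : 'M[C]_(p, q)) : F \is a mxOver Num.real ->
  repair X (hadamard F Y) = repair (hadamard F X) Y.
Proof.
move=> /mxOverP F_real; rewrite !repair_sum; congr ('Re _).
apply: eq_bigr => j _; apply: eq_bigr => i _.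
by rewrite !mxE rmorphM /= (CrealP (F_real i j)) mulrCA mulrA.
Qed.

(** The pairing of X with itself is the sum of the |X i j|^2. *)
Lemma repair_def p q (X : 'M[C]_(p, q)) : repair X X = 0 -> X = 0.
Proof.
have sqr_ge0 (x : C) : 0 <= x^* * x by rewrite mulrC mul_conjC_ge0.
have col_ge0 j : 0 <= \sum_i (X i j)^* * X i j by apply: sumr_ge0.
rewrite repair_sum (Creal_ReP _ _); last first.
  by rewrite ger0_real // sumr_ge0.
move/(psumr_eq0P (fun j _ => col_ge0 j)) => X0; apply/matrixP => i j.
have /(psumr_eq0P (fun i _ => sqr_ge0 (X i j)))/(_ i isT)/eqP := X0 j isT.
by rewrite mulrC mul_conjC_eq0 => /eqP ->; rewrite mxE.
Qed.

(** This is the uniqueness of the derivative: a real linear form in dA is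
    represented by at most one matrix. *)
Lemma repairI p q (X Y : 'M[C]_(p, q)) : repair X =1 repair Y -> X = Y.
Proof.
move=> XY; apply/subr0_eq/repair_def.
by rewrite repairDl repairNl XY subrr.
Qed.

(** Both halves of the bracket are brought to W: the half W^H contributes
    (F o P)^H, which is - F o P^H because F is real and antisymmetric. *)
Lemma repair_hadamard_herm k (F P W : 'M[C]_k) :
    F \is a mxOver Num.real -> F^T = - F ->
  repair P (hadamard F (W + W ^t*)) = repair (hadamard F (P - P ^t*)) W.
Proof.
move=> F_real FN; rewrite repair_hadamard // repairDr repair_trmxC -repairDl.
congr repair; apply/matrixP => i j.
have Fji : F j i = - F i j by move/matrixP: FN => /(_ i j); rewrite !mxE.
rewrite !mxE Fji rmorphM rmorphN /= (CrealP (mxOverP F_real i j)).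
by rewrite mulNr -mulrBr.
Qed.

(** * The adjoints of the SVD-inv differentials *)

Variables (m n k : nat) (U : 'M[C]_(m, k)) (V : 'M[C]_(n, k)).
Variables (F T S Si : 'M[C]_k).
Hypotheses (F_real : F \is a mxOver Num.real) (F_anti : F^T = - F).
Hypothesis T_real : T \is a mxOver Num.real.
Hypotheses (S_herm : S ^t* = S) (Si_herm : Si ^t* = Si).

(** The factor I - U U^H is Hermitian, so it comes back unchanged; in the other
    terms the adjoint of dA |-> U^H dA V is W |-> U W V^H, which puts the
    brackets back between U and V^H. *)
Lemma dU_adjoint (Ubar : 'M[C]_(m, k)) (dA : 'M[C]_(m, n)) :
  repair Ubar
    (U *m (hadamard F (U ^t* *m dA *m V *m S + S *m V ^t* *m dA ^t* *m U)
           + hadamard T (U ^t* *m dA *m V))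
     + (1%:M - U *m U ^t*) *m dA *m V *m Si)
  = repair (U *m (hadamard F (U ^t* *m Ubar - Ubar ^t* *m U) *m S
                  + hadamard T (U ^t* *m Ubar)) *m V ^t*
            + (1%:M - U *m U ^t*) *m Ubar *m Si *m V ^t*) dA.
Proof.
(* The bracket is M S + (M S)^H for M = U^H dA V, as S is Hermitian. *)
have -> : S *m V ^t* *m dA ^t* *m U = (U ^t* *m dA *m V *m S) ^t*.
  by rewrite !trmxC_mul trmxCK S_herm !mulmxA.
rewrite repairDr repair_mulmxl repairDr repair_hadamard_herm //.
rewrite trmxC_mul trmxCK repair_mulmxr S_herm repair_hadamard // -repairDl.
rewrite repair_mulmx trmxCK repair_mulmxr repair_mulmx trmxC_compl.
by rewrite Si_herm !mulmxA -repairDl.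
Qed.

Lemma dS_adjoint (Sbar : 'M[C]_k) (dA : 'M[C]_(m, n)) :
  repair Sbar (hadamard 1%:M (U ^t* *m dA *m V))
  = repair (U *m hadamard 1%:M Sbar *m V ^t*) dA.
Proof.
rewrite repair_hadamard ?repair_mulmx ?trmxCK //.
by rewrite mxOver_scalar ?rpred0 ?rpred1.
Qed.

(** Compared with dU, the bracket is S M + (S M)^H, which places S on the left
    of the Hadamard product, and the orthogonal term depends on dA^H, which
    transposes Vbar. *)
Lemma dV_adjoint (Vbar : 'M[C]_(n, k)) (dA : 'M[C]_(m, n)) :
  repair Vbar
    (V *m hadamard F (S *m U ^t* *m dA *m V + V ^t* *m dA ^t* *m U *m S)
     + (1%:M - V *m V ^t*) *m dA ^t* *m U *m Si)
  = repair (U *m S *m hadamard F (V ^t* *m Vbar - Vbar ^t* *m V) *m V ^t*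
            + U *m Si *m Vbar ^t* *m (1%:M - V *m V ^t*)) dA.
Proof.
have -> : V ^t* *m dA ^t* *m U *m S = (S *m U ^t* *m dA *m V) ^t*.
  by rewrite !trmxC_mul trmxCK S_herm !mulmxA.
rewrite repairDr repair_mulmxl repair_hadamard_herm //.
rewrite trmxC_mul trmxCK repair_mulmx trmxC_mul trmxCK S_herm.
rewrite repair_mulmxr repair_mulmx repair_trmxC -repairDl.
by rewrite !trmxC_mul !trmxC_compl !trmxCK !mulmxA.
Qed.

End Adjoint.

(** * Real matrices seen as complex matrices *)

Section RealMatrices.
Variable R : realType.

Lemma toC_real p q (X : 'M[R]_(p, q)) :
  (toC X : 'M[R[i] : numClosedFieldType]_(p, q)) \is a mxOver Num.real.
Proof. by apply/mxOverP => i j; rewrite mxE complex_real. Qed.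

Lemma trmxC_toC p q (X : 'M[R]_(p, q)) : (toC X) ^t* = toC X^T.
Proof.
apply/matrixP => i j; rewrite !mxE.
by apply: conj_Creal; rewrite complex_real.
Qed.

Lemma trmxC_toC_diag k (s : 'rV[R]_k) :
  (toC (diag_mx s)) ^t* = toC (diag_mx s).
Proof. by rewrite trmxC_toC tr_diag_mx. Qed.

Lemma Fmx_anti k (s : 'rV[R]_k) : (Fmx s)^T = - Fmx s.
Proof.
apply/matrixP => i j; rewrite !mxE eq_sym.
case: ifP => _; first by rewrite rmorph0 oppr0.
by rewrite -rmorphN -opprB invrN mulrN.
Qed.

(** A real factor commutes with taking real parts, so pairing with a real matrix
    sees the real part of the other argument only. *)
Lemma repair_toC_Remx k (D : 'M[R]_k) (W : 'M[R[i]]_k) :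
  repair (toC D) (toC (Remx W)) = repair (toC D) W.
Proof.
rewrite !repair_sum !raddf_sum; apply: eq_bigr => j _.
rewrite !raddf_sum; apply: eq_bigr => i _; rewrite !mxE /= complexRe.
have := mxOverP (toC_real D) i j; rewrite mxE => D_real.
by rewrite conj_Creal // !ReMl // (Creal_ReP _ (Creal_Re _)).
Qed.

Lemma cmxK p q (Z : 'M[R[i]]_(p, q)) : cmx (Remx Z) (Immx Z) = Z.
Proof. by apply/matrixP => i j; rewrite !mxE; case: (Z i j). Qed.

Lemma dloss_repair m n k (Ubar dU : 'M[R[i]]_(m, k)) (Sbar : 'M[R]_k)
    (dS : 'M[R[i]]_k) (Vbar dV : 'M[R[i]]_(n, k)) :
  real_complex R (dloss Ubar Sbar Vbar dU dS dV)
  = repair Ubar dU + repair (toC Sbar) dS + repair Vbar dV.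
Proof. by rewrite [LHS]complexRe !raddfD. Qed.

(** This connects the differential of the loss, which takes a real dS, with its
    expression on the SVD-inv differential dS, which is complex. *)
Lemma dloss_toC_Remx m n k (Ubar dU : 'M[R[i]]_(m, k)) (Sbar : 'M[R]_k)
    (dS : 'M[R[i]]_k) (Vbar dV : 'M[R[i]]_(n, k)) :
  dloss Ubar Sbar Vbar dU (toC (Remx dS)) dV
  = dloss Ubar Sbar Vbar dU dS dV.
Proof.
by apply: (@complexI R); rewrite !dloss_repair repair_toC_Remx.
Qed.

End RealMatrices.

Theorem theorem3p2 (R : realType) (m n k : nat) (A : 'M[R[i]]_(m, n))
    (U : 'M[R[i]]_(m, k)) (s : 'rV[R]_k) (V : 'M[R[i]]_(n, k))
    (L : 'M[R[i]]_(m, k) -> 'M[R]_k -> 'M[R[i]]_(n, k) -> R)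
    (Ubar : 'M[R[i]]_(m, k)) (Sbar : 'M[R]_k) (Vbar : 'M[R[i]]_(n, k))
    (hsvd : is_svd A U s V)
    (hrank : (\rank A < k)%N)
    (hk : (k < minn m n)%N)
    (hbar : partial_derivatives L Ubar Sbar Vbar U (diag_mx s) V)
    (G : 'M[R[i]]_(m, n)) :
  is_svdinv_derivative L Ubar Sbar Vbar U s V G <->
  G = U *m (hadamard (Fmx s) (U ^t* *m Ubar - Ubar ^t* *m U) *m toC (diag_mx s)
            + hadamard (Tmx s) (U ^t* *m Ubar)) *m V ^t*
      + (1%:M - U *m U ^t*) *m Ubar *m Sinv s *m V ^t*
      + U *m hadamard 1%:M (toC Sbar) *m V ^t*
      + U *m toC (diag_mx s)
          *m hadamard (Fmx s) (V ^t* *m Vbar - Vbar ^t* *m V) *m V ^t*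
      + U *m Sinv s *m Vbar ^t* *m (1%:M - V *m V ^t*).
Proof.
set rhs := (X in _ <-> G = X).
have adjoint dA : real_complex R (dloss Ubar Sbar Vbar
    (svdinv_dU U s V dA) (svdinv_dS U V dA) (svdinv_dV U s V dA))
    = repair rhs dA.
  rewrite dloss_repair (dU_adjoint U V (toC_real _) (Fmx_anti s) (toC_real _)
    (trmxC_toC_diag _) (trmxC_toC_diag _)).
  rewrite (dS_adjoint U V) (dV_adjoint U V _ (toC_real _) (Fmx_anti s)
    (trmxC_toC_diag _)).
  by rewrite -!repairDl !addrA.
have pairE dA :
    real_complex R (complex.Re (\tr (G ^t* *m dA))) = repair G dA.
  exact: complexRe.
split=> [derG|Grhs].
  apply: repairI => dA; have [_ dlossG] := derG dA.
  by rewrite -pairE -dlossG adjoint.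
move=> dA dU dS dV; split; last first.
  by apply: (@complexI R); rewrite pairE Grhs adjoint.
by rewrite (@diff_val _ _ _ _ _ _ _ hbar) /in_coords /coords !cmxK dloss_toC_Remx.
Qed.
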